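(* Let $N\ge 1$ be an integer and let the $q$-hypergeometric Bernoulli numbers $\mathcal B_{N,k}$ be defined by $\sum_{k=0}^\infty\mathcal B_{N,k}\frac{x^k}{k!}=\left(\sum_{j=0}^\infty\frac{[N]_q!}{[N+j]_q!}x^j\right)^{-1}$. Then $$\sum_{k=0}^\infty\mathcal B_{N,k}\frac{x^k}{k!}=1-\cfrac{x}{[N+1]_q+x-\cfrac{[N+1]_q x}{[N+2]_q+x-\cfrac{[N+2]_q x}{[N+3]_q+x-\ddots}}}$$ as formal power series in $x$.
   Context: $q\ne 1$ is a complex number that is not a root of unity; $[n]_q=\frac{1-q^n}{1-q}$, $[n]_q!=[n]_q[n-1]_q\cdots[1]_q$ for $n\ge1$, and $[0]_q!=1$. The infinite continued fraction is the limit, in the $x$-adic topology on formal power series, of its finite truncations (the $n$-th one ending with the partial denominator $[N+n]_q+x$), each truncation being a rational function of $x$ expanded as a formal power series at $x=0$. *)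

(* Defs.v *)
From HB Require Import structures.
From mathcomp Require Import all_boot all_order all_algebra.
From mathcomp Require Import boolp reals.
From mathcomp Require Export complex.

Set Implicit Arguments.
Unset Strict Implicit.
Unset Printing Implicit Defensive.

Import GRing.Theory.
Local Open Scope ring_scope.

(* [FPS f] is the formal power series \sum_k (f k) x^k; the coercion makes
   [f k] the coefficient of x^k in the series f. *)
Record fps (K : Type) := FPS { fpscoef :> nat -> K }.

Lemma fpsP (K : Type) (f g : fps K) : (forall k, f k = g k) <-> f = g.
Proof.
split=> [|-> //]; case: f g => [f] [g] /= fg.
by congr FPS; apply: funext.
Qed.

HB.instance Definition _ (K : Type) := gen_eqMixin (fps K).
HB.instance Definition _ (K : Type) := gen_choiceMixin (fps K).

Section FpsRing.
Variable K : comNzRingType.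
Implicit Types f g h : fps K.

Definition fps_zero : fps K := FPS (fun=> 0).
Definition fps_one : fps K := FPS (fun k => (k == 0)%:R).
Definition fps_add f g := FPS (fun k => f k + g k).
Definition fps_opp f := FPS (fun k => - f k).
Definition fps_mul f g := FPS (fun k => \sum_(i < k.+1) f i * g (k - i)%N).

Fact fps_addA : associative fps_add.
Proof. by move=> f g h; apply/fpsP => k /=; rewrite addrA. Qed.
Fact fps_addC : commutative fps_add.
Proof. by move=> f g; apply/fpsP => k /=; rewrite addrC. Qed.
Fact fps_add0 : left_id fps_zero fps_add.
Proof. by move=> f; apply/fpsP => k /=; rewrite add0r. Qed.
Fact fps_addN : left_inverse fps_zero fps_opp fps_add.
Proof. by move=> f; apply/fpsP => k /=; rewrite addNr. Qed.

HB.instance Definition _ :=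
  GRing.isZmodule.Build (fps K) fps_addA fps_addC fps_add0 fps_addN.

Let trunc n f : {poly K} := \poly_(i < n) f i.

Let mul_trunc n f g k : (k < n)%N -> fps_mul f g k = (trunc n f * trunc n g)`_k.
Proof.
move=> kn; rewrite coefM /=; apply: eq_bigr => -[i /=]; rewrite ltnS => ik _.
by rewrite !coef_poly (leq_ltn_trans ik kn) (leq_ltn_trans (leq_subr _ _) kn).
Qed.

Fact fps_mulC : commutative fps_mul.
Proof. by move=> f g; apply/fpsP => k; rewrite !(@mul_trunc k.+1)// mulrC. Qed.

Fact fps_mulA : associative fps_mul.
Proof.
move=> f g h; apply/fpsP => k; rewrite !(@mul_trunc k.+1)//.
transitivity ((trunc k.+1 f * (trunc k.+1 g * trunc k.+1 h))`_k).
  rewrite !coefM; apply: eq_bigr => i _; congr (_ * _).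
  by rewrite coef_poly ltnS leq_subr (@mul_trunc k.+1)// ltnS leq_subr.
rewrite mulrA !coefM; apply: eq_bigr => i _; congr (_ * _).
by rewrite [RHS]coef_poly ltn_ord (@mul_trunc k.+1).
Qed.

Fact fps_mul1 : left_id fps_one fps_mul.
Proof.
move=> f; apply/fpsP => k /=; rewrite big_ord_recl /= mul1r subn0.
by rewrite big1 ?addr0// => i _; rewrite mul0r.
Qed.

Fact fps_mulDl : left_distributive fps_mul fps_add.
Proof.
move=> f g h; apply/fpsP => k /=.
by rewrite -big_split; apply: eq_bigr => i _; rewrite mulrDl.
Qed.

Fact fps_oner_neq0 : fps_one != fps_zero.
Proof. by apply/eqP => /fpsP/(_ 0%N)/eqP; rewrite (negPf (oner_neq0 K)). Qed.

HB.instance Definition _ := GRing.Zmodule_isComNzRing.Build (fps K)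
  fps_mulA fps_mulC fps_mul1 fps_mulDl fps_oner_neq0.

Lemma fps0E k : (0 : fps K) k = 0. Proof. by []. Qed.
Lemma fps1E k : (1 : fps K) k = (k == 0)%:R. Proof. by []. Qed.
Lemma fpsDE f g k : (f + g) k = f k + g k. Proof. by []. Qed.
Lemma fpsNE f k : (- f) k = - f k. Proof. by []. Qed.
Lemma fpsBE f g k : (f - g) k = f k - g k. Proof. by []. Qed.
Lemma fpsME f g k : (f * g) k = \sum_(i < k.+1) f i * g (k - i)%N.
Proof. by []. Qed.

Definition fps_of_poly (p : {poly K}) : fps K := FPS (fun k => p`_k).

Fact fps_of_poly_zmod_morphism : zmod_morphism fps_of_poly.
Proof. by move=> p r; apply/fpsP => k /=; rewrite coefB. Qed.
Fact fps_of_poly_monoid_morphism : monoid_morphism fps_of_poly.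
Proof.
split; first by apply/fpsP => k /=; rewrite coef1.
by move=> p r; apply/fpsP => k /=; rewrite coefM.
Qed.
HB.instance Definition _ :=
  GRing.isZmodMorphism.Build {poly K} (fps K) fps_of_poly
    fps_of_poly_zmod_morphism.
HB.instance Definition _ :=
  GRing.isMonoidMorphism.Build {poly K} (fps K) fps_of_poly
    fps_of_poly_monoid_morphism.

Lemma fps_of_polyE p k : fps_of_poly p k = p`_k. Proof. by []. Qed.

(* The ideals x^m K[[x]] form a neighbourhood base of 0 for the x-adic
   topology. *)
Definition xadic_cvg (T : nat -> fps K) (f : fps K) : Prop :=
  forall m, exists n0, forall n, (n0 <= n)%N ->
    exists g, T n - f = fps_of_poly 'X ^+ m * g.

Lemma fpsXnME m g k :
  (fps_of_poly 'X ^+ m * g) k = if (k < m)%N then 0 else g (k - m)%N.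
Proof.
rewrite -rmorphXn fpsME /=; case: ltnP => km.
  rewrite big1 // => i _; rewrite coefXn.
  by rewrite (ltn_eqF (leq_trans (ltn_ord i) km)) mul0r.
rewrite (bigD1 (Ordinal (km : (m < k.+1)%N))) //= coefXn eqxx mul1r.
rewrite big1 ?addr0 // => i; rewrite -val_eqE /= => /negPf im.
by rewrite coefXn im mul0r.
Qed.

Lemma xadic_cvgP T f : xadic_cvg T f <->
  (forall k, exists n0, forall n, (n0 <= n)%N -> T n k = f k).
Proof.
split=> [Tf k|Tf m].
  have [n0 H] := Tf k.+1; exists n0 => n /H[g /fpsP/(_ k)].
  by rewrite fpsXnME ltnSn fpsBE => /eqP; rewrite subr_eq0 => /eqP.
have [n0 H] : exists n0, forall n, (n0 <= n)%N ->
    forall k, (k < m)%N -> T n k = f k.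
  elim: m => [|m [n0 H]]; first by exists 0%N.
  have [n1 H1] := Tf m; exists (maxn n0 n1) => n; rewrite geq_max.
  move=> /andP[n0n n1n] k; rewrite ltnS leq_eqVlt => /predU1P[->|km].
    exact: H1.
  exact: H.
exists n0 => n /H {}H; exists (FPS (fun k => (T n - f) (k + m)%N)).
apply/fpsP => k; rewrite fpsXnME; case: ltnP => km /=; last by rewrite subnK.
by rewrite H// subrr.
Qed.

Lemma xadic_cvg_unique T f g : xadic_cvg T f -> xadic_cvg T g -> f = g.
Proof.
move=> /xadic_cvgP Tf /xadic_cvgP Tg; apply/fpsP => k.
have [m Hm] := Tf k; have [n Hn] := Tg k.
by rewrite -(Hm (maxn m n)) ?leq_maxl// (Hn (maxn m n))// leq_maxr.
Qed.

End FpsRing.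

Section FpsUnitRing.
Variable K : fieldType.
Implicit Types f g : fps K.

Fixpoint fps_inv_seq f n : seq K :=
  if n is m.+1 then
    let s := fps_inv_seq f m in
    rcons s ((f 0%N)^-1 * ((m == 0)%:R - \sum_(i < m) f (m - i)%N * s`_i))
  else [::].

Definition fps_unit : pred (fps K) := fun f => f 0%N != 0.
Definition fps_inv f :=
  if fps_unit f then FPS (fun k => (fps_inv_seq f k.+1)`_k) else f.

Let size_inv f n : size (fps_inv_seq f n) = n.
Proof. by elim: n => //= n IHn; rewrite size_rcons IHn. Qed.

Let nth_inv f n k :
  (k < n)%N -> (fps_inv_seq f n)`_k = (fps_inv_seq f k.+1)`_k.
Proof.
elim: n => // n IHn; rewrite ltnS leq_eqVlt => /predU1P[-> //|kn].
by rewrite [LHS]/= nth_rcons size_inv kn IHn.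
Qed.

Fact fps_mulVr : {in fps_unit, left_inverse 1 fps_inv *%R}.
Proof.
move=> f fu; have f0 : f 0%N != 0 by exact: fu.
rewrite /fps_inv ifT //; apply/fpsP => k; rewrite fpsME big_ord_recr /= subnn.
rewrite nth_rcons size_inv ltnn eqxx mulrAC mulVf// mul1r.
rewrite -[RHS](addrNK (\sum_(i < k) f (k - i)%N * (fps_inv_seq f k)`_i)).
rewrite addrC; congr (_ + _); apply: eq_bigr => i _.
by rewrite (nth_inv _ (ltn_ord i)) mulrC.
Qed.

Fact fps_unitPl f g : g * f = 1 -> fps_unit f.
Proof.
move=> /fpsP/(_ 0%N); rewrite fpsME big_ord1 subnn /= => gf.
apply/eqP => f0; move: gf; rewrite f0 mulr0 => /esym/eqP.
by rewrite (negPf (oner_neq0 K)).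
Qed.

Fact fps_inv_out : {in [predC fps_unit], fps_inv =1 id}.
Proof. by move=> f /negPf fu; rewrite /fps_inv ifF. Qed.

HB.instance Definition _ := GRing.ComNzRing_hasMulInverse.Build (fps K)
  fps_mulVr fps_unitPl fps_inv_out.

Lemma fps_unitE f : (f \is a GRing.unit) = (f 0%N != 0).
Proof. by []. Qed.

(* f is the expansion at x = 0 of the rational function r. *)
Definition is_expansion0 (r : {fraction {poly K}}) (f : fps K) : Prop :=
  exists p d : {poly K}, [/\ d.[0] != 0, r = tofrac p / tofrac d
    & f = fps_of_poly p / fps_of_poly d].

Lemma is_expansion0_unique r f g :
  is_expansion0 r f -> is_expansion0 r g -> f = g.
Proof.
move=> [p [d [d0 -> ->]]] [p' [d' [d'0 E ->]]].
have nz (s : {poly K}) : s.[0] != 0 -> tofrac s != 0.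
  by rewrite tofrac_eq0; apply: contraNneq => ->; rewrite horner0.
have un (s : {poly K}) : s.[0] != 0 -> fps_of_poly s \is a GRing.unit.
  by rewrite fps_unitE horner_coef0.
move/eqP: E; rewrite eqr_div ?nz// -!tofracM tofrac_eq => /eqP E.
apply: (mulIr (un _ d0)); rewrite divrK ?un// mulrAC.
apply: (mulIr (un _ d'0)); rewrite divrK ?un//.
by rewrite -!rmorphM E.
Qed.

(* b_0 - a_0/(b_1 - a_1/( ... - a_{n-1}/b_n)), a rational function.  A zero
   denominator would follow the convention r / 0 = 0; none occurs when the b_j
   have nonzero, and the a_j zero, constant coefficient. *)
Fixpoint cfrac_trunc (a b : nat -> {poly K}) (n : nat) : {fraction {poly K}} :=
  if n is m.+1 then
    tofrac (b 0%N)
      - tofrac (a 0%N) / cfrac_trunc (fun j => a j.+1) (fun j => b j.+1) m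
  else tofrac (b 0%N).

(* f = b_0 - a_0/(b_1 - a_1/(b_2 - ...)) as formal power series; this includes
   that every truncation has an expansion at x = 0. *)
Definition is_cfrac (a b : nat -> {poly K}) (f : fps K) : Prop :=
  exists T : nat -> fps K,
    (forall n, is_expansion0 (cfrac_trunc a b n) (T n)) /\ xadic_cvg T f.

Lemma is_cfrac_unique a b f g : is_cfrac a b f -> is_cfrac a b g -> f = g.
Proof.
move=> [S [HS Sf]] [T [HT Tg]]; apply: (@xadic_cvg_unique _ S) => //.
rewrite (_ : S = T)//; apply: funext => n.
exact: is_expansion0_unique (HS n) (HT n).
Qed.

Definition qnum (q : K) (n : nat) : K := (1 - q ^+ n) / (1 - q).

Definition qfact (q : K) (n : nat) : K := \prod_(1 <= i < n.+1) qnum q i.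

Definition qhypgeom (q : K) (N : nat) : fps K :=
  FPS (fun j => qfact q N / qfact q (N + j)).

(* The coefficient of x^k / k! in 1 / qhypgeom q N. *)
Definition qhbern (q : K) (N k : nat) : K := k`!%:R * (qhypgeom q N)^-1 k.

End FpsUnitRing.

Lemma qhbern_egf (R : rcfType) (q : R[i]) (N : nat) :
  FPS (fun k => qhbern q N k / k`!%:R) = (qhypgeom q N)^-1.
Proof.
apply/fpsP => k /=; rewrite /qhbern mulrAC mulfV ?mul1r//.
by rewrite Num.Theory.pnatr_eq0 -lt0n fact_gt0.
Qed.

Lemma qhypgeom_unit (K : fieldType) (q : K) (N : nat) : q != 1 ->
  (forall n, (0 < n)%N -> ~~ n.-unity_root q) ->
  qhypgeom q N \is a GRing.unit.
Proof.
move=> q1 hq; rewrite fps_unitE /= addn0 mulf_neq0 ?invr_eq0//;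
  rewrite /qfact prodf_seq_neq0; apply/allP => i;
  rewrite mem_index_iota => /andP[i0 _] /=;
  rewrite mulf_neq0 ?invr_eq0 ?subr_eq0 1?[_ == q]eq_sym//;
  by rewrite eq_sym -unity_rootE hq.
Qed.

(* Main.v *)
Require Import Defs.
From mathcomp Require Import all_boot all_order all_algebra.
From mathcomp Require Import reals.
Import GRing.Theory.
Local Open Scope ring_scope.

(** The continued fraction is the one that Euler attaches to a series.  Put
    c_j = [N+j]_q; these are nonzero because q is not a root of unity, and the
    series to be inverted is \sum_j x^j / (c_1 ... c_j).  The n-th truncation
    of the continued fraction is exactly the reciprocal of the n-th partial sum
    of this series ([cfrac_trunc_euler]), and taking reciprocals is continuous
    for the x-adic topology ([xadic_cvgV]), so the truncations converge to the
    reciprocal of the series.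

    For the exact formula, let P_n(c_0, c_1, ...) be the partial sum
    \sum_(j <= n) x^j / (c_0 ... c_(j-1)).  Factoring out x / c_0 gives
      c_0 P_(n+1)(c_0, c_1, ...) = c_0 + x P_n(c_1, c_2, ...),
    and by this recurrence the tails of the continued fraction telescope: the
    tail starting at c_0 is c_0 P_(n+1)(c_0, c_1, ...) / P_n(c_1, c_2, ...)
    ([cfrac_trunc_euler_tail]). *)

Section EulerContinuedFraction.
Variable K : fieldType.
Implicit Types (c : nat -> K) (f : fps K) (T : nat -> fps K).

Definition recip_prod_psum c n : {poly K} :=
  \poly_(i < n.+1) \prod_(j < i) (c j)^-1.

Lemma recip_prod_psum0 c : recip_prod_psum c 0 = 1.
Proof.
apply/polyP => -[|k]; rewrite coef_poly coef1 //=.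
by rewrite big_ord0.
Qed.

Lemma recip_prod_psumS c n : c 0%N != 0 ->
  c 0%N *: recip_prod_psum c n.+1 =
  (c 0%N)%:P + 'X * recip_prod_psum (fun j => c j.+1) n.
Proof.
move=> c0; apply/polyP => k.
rewrite coefZ coefD coefC coefXM !coef_poly.
case: k => [|k] /=; first by rewrite big_ord0 mulr1 addr0.
rewrite add0r !ltnS; case: ifP => _; last by rewrite mulr0.
by rewrite big_ord_recl mulVKf.
Qed.

Lemma horner0_recip_prod_psum c n : (recip_prod_psum c n).[0] = 1.
Proof. by rewrite horner_coef0 coef_poly big_ord0. Qed.

Lemma tofrac_recip_prod_psum_neq0 c n : tofrac (recip_prod_psum c n) != 0.
Proof.
rewrite tofrac_eq0; apply/eqP => p0.
by have /eqP := horner0_recip_prod_psum c n; rewrite p0 horner0 eq_sym oner_eq0.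
Qed.

(** The left-hand side, up to the factor c_j of the partial numerator, is what
    each level of the continued fraction subtracts. *)
Lemma mul_recip_prod_psum_ratio c n : c 0%N != 0 ->
  tofrac 'X * (tofrac (recip_prod_psum (fun j => c j.+1) n)
    / tofrac (c 0%N *: recip_prod_psum c n.+1)) =
  1 - (tofrac (recip_prod_psum c n.+1))^-1.
Proof.
move=> c0; have cn0 : tofrac (c 0%N)%:P != 0 by rewrite tofrac_eq0 polyC_eq0.
have sn0 := tofrac_recip_prod_psum_neq0 c n.+1.
rewrite mulrA -tofracM.
(* The recurrence for the partial sums, solved for its last term. *)
have -> : 'X * recip_prod_psum (fun j => c j.+1) n =
    (c 0%N)%:P * (recip_prod_psum c n.+1 - 1).
  by rewrite mulrBr mulr1 mul_polyC recip_prod_psumS // addrC addKr.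
rewrite -mul_polyC !tofracM tofracB tofrac1 -mulf_div (divff cn0) mul1r.
by rewrite mulrBl (divff sn0) mul1r.
Qed.

(** When a level is placed under the one above it, its denominator
    P_n(c_1, c_2, ...) meets the factor x and is absorbed by the recurrence, and
    its numerator becomes the denominator of the new level; so the values stay
    quotients of two partial sums. *)
Lemma cfrac_trunc_euler_tail c n : (forall j, c j != 0) ->
  cfrac_trunc (fun j => c j *: 'X) (fun j => (c j)%:P + 'X) n =
  tofrac (c 0%N *: recip_prod_psum c n.+1)
    / tofrac (recip_prod_psum (fun j => c j.+1) n).
Proof.
elim: n c => [|n IHn] c cn0 /=.
  by rewrite recip_prod_psumS // recip_prod_psum0 tofrac1 divr1 mulr1.
rewrite (IHn (fun j => c j.+1) (fun j => cn0 j.+1)) invf_div.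
rewrite -mul_polyC tofracM -mulrA.
rewrite (mul_recip_prod_psum_ratio (fun j => c j.+1) n (cn0 1%N)).
rewrite (recip_prod_psumS c n.+1 (cn0 0%N)) !tofracD tofracM.
rewrite mulrBr mulr1 opprB mulrDl (mulfK (tofrac_recip_prod_psum_neq0 _ _)).
by rewrite [LHS]addrC addrA subrK.
Qed.

Lemma cfrac_trunc_euler c n : (forall j, c j.+1 != 0) ->
  cfrac_trunc (fun j => if j == 0%N then 'X else c j *: 'X)
    (fun j => if j == 0%N then 1 else (c j)%:P + 'X) n =
  (tofrac (recip_prod_psum (fun j => c j.+1) n))^-1.
Proof.
move=> cn0; case: n => [|n] /=; first by rewrite recip_prod_psum0 tofrac1 invr1.
rewrite (cfrac_trunc_euler_tail (fun j => c j.+1) n cn0) invf_div.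
rewrite (mul_recip_prod_psum_ratio (fun j => c j.+1) n (cn0 0%N)) tofrac1.
by rewrite opprB addrC subrK.
Qed.

(** If x^m divides T_n - f, it also divides (f - T_n) / (T_n f). *)
Lemma xadic_cvgV T f : f \is a GRing.unit ->
  (forall n, T n \is a GRing.unit) -> xadic_cvg T f ->
  xadic_cvg (fun n => (T n)^-1) f^-1.
Proof.
move=> fu Tu Tf m; have [n0 H] := Tf m; exists n0 => n /H[g Tg].
exists (- g / (T n * f)).
rewrite mulrA mulrN -Tg opprB (invrM (Tu n) fu) mulrBl (mulVKr fu).
by rewrite mulrCA (divrr (Tu n)) mulr1.
Qed.

(** Euler's continued fraction of the reciprocal of a series, for series given
    by the ratios 1 / c_(j+1) of their consecutive coefficients. *)
Lemma is_cfrac_euler c f : (forall j, c j.+1 != 0) ->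
  (forall k, f k = \prod_(j < k) (c j.+1)^-1) ->
  is_cfrac (fun j => if j == 0%N then 'X else c j *: 'X)
    (fun j => if j == 0%N then 1 else (c j)%:P + 'X) f^-1.
Proof.
move=> cn0 fE; set P := recip_prod_psum (fun j => c j.+1).
exists (fun n => (fps_of_poly (P n))^-1); split=> [n|].
  exists 1, (P n); split; first by rewrite horner0_recip_prod_psum oner_eq0.
    by rewrite cfrac_trunc_euler // tofrac1 div1r.
  by rewrite rmorph1 div1r.
apply: xadic_cvgV => [|n|].
- by rewrite fps_unitE fE big_ord0 oner_eq0.
- by rewrite fps_unitE fps_of_polyE -horner_coef0 horner0_recip_prod_psum
             oner_eq0.
apply/xadic_cvgP => k; exists k => n kn.
by rewrite fps_of_polyE coef_poly ltnS kn fE.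
Qed.

Lemma qnum_neq0 (q : K) n : q != 1 -> ~~ n.-unity_root q -> qnum q n != 0.
Proof.
move=> q1 qn; rewrite mulf_neq0 ?invr_eq0 ?subr_eq0 // eq_sym //.
by rewrite -unity_rootE.
Qed.

Lemma qhypgeomE (q : K) N k : (forall n, (0 < n)%N -> qnum q n != 0) ->
  qhypgeom q N k = \prod_(j < k) (qnum q (N + j.+1))^-1.
Proof.
move=> qn0; rewrite /= prodfV /qfact.
rewrite (@big_cat_nat _ _ _ N.+1 1 (N + k).+1) //= ?ltnS ?leq_addr //.
rewrite invfM mulrA mulfV ?mul1r; last first.
  rewrite prodf_seq_neq0; apply/allP => i.
  by rewrite mem_index_iota => /andP[i0 _]; exact: qn0.
congr _^-1; rewrite -addSn -{1}[N.+1]add0n big_addn addKn big_mkord.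
by apply: eq_bigr => i _; rewrite addnC addSnnS.
Qed.

End EulerContinuedFraction.

Theorem theorem2 (R : realType) (q : R[i]) (N : nat)
    (hq1 : q != 1)
    (hq : forall n : nat, (0 < n)%N -> ~~ n.-unity_root q)
    (hN : (1 <= N)%N) :
  is_cfrac
    (fun j => if j == 0%N then 'X else qnum q (N + j) *: 'X)
    (fun j => if j == 0%N then 1 else (qnum q (N + j))%:P + 'X)
    (FPS (fun k => qhbern q N k / k`!%:R)).
Proof.
have qn0 n : (0 < n)%N -> qnum q n != 0.
  by move=> n0; apply: qnum_neq0 => //; apply: hq.
rewrite qhbern_egf.
apply: (@is_cfrac_euler _ (fun j => qnum q (N + j))) => [j|k].
  by rewrite qn0 // addnS.
exact: qhypgeomE.
Qed.
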